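(* Let $U$ be a real constant such that $0<U<1$. Then there is a constant $\Psi_U$ (depending only on $U$) such that for every $n\in\mathbb{N}$ and every (not necessarily connected) graph $G$ on $n$ vertices with $\Delta(G)\leq Un$, \[ \min\{\mathcal{K}(G),\,\mathcal{K}(\overline{G})\}\;\leq\; n\,\Psi_U . \]
   Context: Graphs are finite, simple, undirected and unweighted; they are not assumed connected here. $\overline{G}$ is the complement of $G$ (same vertex set; distinct $i,j$ are adjacent in $\overline{G}$ iff they are not adjacent in $G$). $\Delta(G)$ is the maximum vertex degree. For a connected graph $G$ with vertex set $\{1,\dots,n\}$, $m$ edges and vertex degrees $d_1,\dots,d_n$, Kemeny's constant is $\mathcal{K}(G)=\sum_{j\neq i}\frac{d_j}{2m}\,m_{i,j}$, where $m_{i,j}$ is the expected first time at which the simple random walk on $G$ (which moves at each step to a uniformly random neighbour) started at $i$ reaches $j$; this value does not depend on the choice of $i$. (For $n=1$ the sum is empty and $\mathcal{K}(G)=0$.) If $G$ is disconnected, $\mathcal{K}(G)=\infty$ by convention. *)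

(* Defs.v *)
From HB Require Import structures.
From mathcomp Require Import all_boot all_order all_algebra.
From mathcomp Require Import all_classical all_reals all_analysis.

Set Implicit Arguments.
Unset Strict Implicit.
Unset Printing Implicit Defensive.

Import Order.TTheory GRing.Theory Num.Theory.
Local Open Scope ring_scope.

Record sgraph (V : finType) := SGraph {
  adj :> rel V;
  adj_sym : symmetric adj;
  adj_irr : irreflexive adj }.

Section Graph.
Variables (V : finType) (G : sgraph V).

Definition compl_adj : rel V := fun x y => (x != y) && ~~ adj G x y.

Lemma compl_adj_sym : symmetric compl_adj.
Proof. by move=> x y; rewrite /compl_adj eq_sym adj_sym. Qed.

Lemma compl_adj_irr : irreflexive compl_adj.
Proof. by move=> x; rewrite /compl_adj eqxx. Qed.

Definition compl : sgraph V := SGraph compl_adj_sym compl_adj_irr.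

Definition degree (x : V) : nat := #|[set y | adj G x y]|.

Definition max_degree : nat := (\max_(x : V) degree x)%N.

Definition edges : {set {set V}} :=
  [set e | [exists x, exists y, adj G x y && (e == [set x; y])]].

Definition connected_graph : bool :=
  [forall x, forall y, connect (adj G) x y].

Variable R : realType.

Definition walk_step (x y : V) : R :=
  if adj G x y then (degree x)%:R^-1 else 0.

(* The probability that the simple random walk started at i visits w_0, ...,
   w_(t-1) at times 1, ..., t; thus i :: w lists its positions at times
   0, ..., t. *)
Definition traj_prob (i : V) (t : nat) (w : t.-tuple V) : R :=
  \prod_(k < t) walk_step (nth i (i :: w) k) (nth i (i :: w) k.+1).

(* P_i(T_j = t): as i :: w has t + 1 entries, the condition says that its first
   occurrence of j is the last entry. *)
Definition hit_prob (i j : V) (t : nat) : R :=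
  \sum_(w : t.-tuple V | index j (i :: w) == t) traj_prob i w.

(* E_i[T_j] for T_j with values in {0, 1, ..., +oo}; the second summand is the
   contribution of the event T_j = +oo (in \bar R, +oo * 0 = 0). *)
Definition hit_time (i j : V) : \bar R :=
  (\sum_(0 <= t <oo) (t%:R * hit_prob i j t)%:E
   + +oo * (1 - \sum_(0 <= t <oo) (hit_prob i j t)%:E))%E.

Definition kemeny_from (i : V) : \bar R :=
  (\sum_(j | j != i) ((degree j)%:R / (2 * #|edges|%:R))%:E * hit_time i j)%E.

(* For connected G, kemeny_from i does not depend on i, so any choice of i will
   do. The graph without vertices gets the value 0. *)
Definition kemeny : \bar R :=
  if connected_graph then
    if [pick i : V] is Some i then kemeny_from i else 0%E
  else +oo%E.

End Graph.

(* Main.v *)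
Require Import Defs.
From HB Require Import structures.
From mathcomp Require Import all_boot all_order all_algebra.
From mathcomp Require Import all_classical all_reals all_analysis.
From mathcomp Require Import zify ring lra.
From mathcomp Require Import fintype finset.

Set Implicit Arguments.
Unset Strict Implicit.
Unset Printing Implicit Defensive.

Import Order.TTheory GRing.Theory Num.Theory.
Import numFieldNormedType.Exports.
Local Open Scope ring_scope.

(** Write n for the number of vertices, k for the integer part of eps * n with
    eps = (1 - U) / 4, and H for the complement of G.

    The degree bound makes one of G and H (k+1)-edge-connected
    ([edge_connected_or_compl]). Suppose that A and B partition the vertices into
    two nonempty sets with at most k edges of H between them. Every vertex has degree at least 3k in H, which forces both A and B to
    have more than 2k vertices. Hence G contains all but k of the pairs in A x B.
    So two vertices on the same side have more than k common neighbours in G,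
    and a cut of G that separates two such vertices has more than k edges; the
    only other cut is A | B itself.

    A graph whose cuts all have at least eps * n edges has hitting times O(n),
    and then Kemeny's constant, an average of hitting times from one vertex, is
    O(n) as well. For the hitting times, let h(x) be the expected time to reach a
    fixed target j from x, truncated at a time N. Then h(j) = 0 and elsewhere the
    Laplacian of h at x is at most the degree of x, so with M = max h the
    Dirichlet energy of h is at most of order n^2 * M ([energy_truncated_hit]). On
    the other hand a nonnegative function that takes the values 0 and M on such a
    graph has energy at least of order n * M^2 ([energy_ge_edge_connected]): its values
    cannot climb from 0 to M through dense clusters of vertices only, because each
    cluster has at least a fixed fraction of the vertices, so that either a gap is
    crossed by a cut of eps * n edges or some vertex has many long edges.
    Comparing the two gives M = O(n) uniformly in N ([truncated_hit_le]), which
    both makes the target almost surely reached and bounds the expectation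
    ([hit_time_le]). The truncation replaces the solution of a Poisson equation,
    whose existence would need an argument, by a subsolution given explicitly. *)

(** * Edge cuts of a graph and of its complement *)

Section Cuts.
Variable V : finType.
Implicit Types (G : sgraph V) (S : {set V}).

Definition cut G S : {set V * V} :=
  [set p | [&& p.1 \in S, p.2 \notin S & adj G p.1 p.2]].

Lemma in_cut G S x y :
  ((x, y) \in cut G S) = [&& x \in S, y \notin S & adj G x y].
Proof. by rewrite inE. Qed.

Definition edge_connected G (k : nat) : Prop :=
  forall S x y, x \in S -> y \notin S -> (k <= #|cut G S|)%N.

Lemma card_cutC G S : #|cut G (~: S)| = #|cut G S|.
Proof.
have swapI : injective (fun p : V * V => (p.2, p.1)) by move=> [a b] [c d] [-> ->].
rewrite -(card_imset _ swapI); apply: eq_card => -[a b].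
rewrite in_cut; apply/imsetP/and3P => [[[c d]]|[aS bS ab]].
  by rewrite in_cut !inE negbK => /and3P[cS dS cd] [-> ->]; rewrite adj_sym.
by exists (b, a); rewrite // in_cut !inE bS negbK aS adj_sym.
Qed.

Lemma degree_ge_edge_connected G k x y :
  edge_connected G k -> x != y -> (k <= degree G x)%N.
Proof.
move=> Gk xy; have yx : y \notin [set x] by rewrite inE eq_sym.
apply: leq_trans (Gk [set x] x y (set11 x) yx) _.
have pairI : injective (fun z : V => (x, z)) by move=> a b [].
rewrite /degree -(card_imset _ pairI).
apply/subset_leq_card/subsetP => -[a b]; rewrite in_cut inE => /and3P[/eqP -> _ xb].
by apply: imset_f; rewrite inE.
Qed.

Lemma edge_connected_connected G k :
  (0 < k)%N -> edge_connected G k -> connected_graph G.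
Proof.
move=> k0 Gk; apply/forallP => x; apply/forallP => y; apply/negPn/negP => xy.
pose S := [set z | connect (adj G) x z].
have : (0 < #|cut G S|)%N.
  by apply: leq_trans k0 (Gk S x y _ _); rewrite inE ?connect0.
case/card_gt0P => -[a b]; rewrite in_cut !inE => /and3P[xa xb ab].
by rewrite (connect_trans xa (connect1 ab)) in xb.
Qed.

(** The common neighbours of [x] and [y] each give a path of length two from
    [S] to its complement, and these paths are edge-disjoint. *)
Lemma common_nbrs_le_cut G S x y (N : {set V}) :
    x \in S -> y \notin S ->
    (forall z, z \in N -> adj G x z && adj G y z) ->
  (#|N| <= #|cut G S|)%N.
Proof.
move=> xS yS Nxy.
pose e z := if z \in S then (z, y) else (x, z).
have xN : x \notin N by apply/negP => /Nxy; rewrite adj_irr.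
have eI : {in N &, injective e}.
  move=> a b aN bN; rewrite /e; do 2![case: ifP => _] => -[] //.
    by move=> ax _; rewrite -ax aN in xN.
  by move=> xb _; rewrite xb bN in xN.
rewrite -(card_in_imset eI); apply/subset_leq_card/subsetP => _ /imsetP[z zN ->].
case/andP: (Nxy z zN) => xz yz; rewrite /e.
by case: ifPn => zS; rewrite in_cut zS ?xS ?yS //= adj_sym.
Qed.

(** A sparse cut of the complement makes [G] nearly complete bipartite: two
    vertices on one side miss at most [k] vertices of the other side. *)
Lemma sparse_compl_cut_same_side G k (A : {set V}) S x y :
    (#|cut (compl G) A| <= k)%N -> (k.*2 < #|~: A|)%N ->
    x \in A -> y \in A -> x \in S -> y \notin S ->
  (k < #|cut G S|)%N.
Proof.
move=> Ak kB xA yA xS yS.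
pose N := [set z in ~: A | adj G x z && adj G y z].
apply: (@leq_trans #|N|); last first.
  by apply: (common_nbrs_le_cut xS yS) => z /[!inE] /andP[].
suff : (#|~: A :\: N| <= k)%N.
  move=> missk; have := cardsID N (~: A).
  rewrite (setIidPr _); last by apply/subsetP => z /[!inE] /andP[].
  lia.
apply: leq_trans Ak.
(* each missed vertex is joined in the complement to [x] or to [y] *)
pose e z := if adj G x z then (y, z) else (x, z).
have eI : injective e by move=> a b; rewrite /e; do 2!case: ifP => _; case.
rewrite -(card_imset _ eI); apply/subset_leq_card/subsetP => _ /imsetP[z zAN ->].
move: zAN; rewrite in_setD [z \in N]inE => /andP[zN zA]; rewrite zA /= in zN.
rewrite inE in zA; rewrite /e.
have neqA u : u \in A -> u != z by apply: contraTneq => ->.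
case: ifPn => xz; rewrite in_cut ?xA ?yA zA /= /compl_adj neqA //=.
by rewrite xz in zN.
Qed.

Lemma sparse_compl_cut_edge_connected G k (A : {set V}) :
    (#|cut (compl G) A| <= k)%N -> (k.*2 < #|A|)%N -> (k.*2 < #|~: A|)%N ->
  edge_connected G k.+1.
Proof.
move=> Ak kA kB S x y xS yS.
have kBB : (k.*2 < #|~: ~: A|)%N by rewrite setCK.
have Bk : (#|cut (compl G) (~: A)| <= k)%N by rewrite card_cutC.
have same C x' y' : C = A \/ C = ~: A ->
    x' \in C -> y' \in C -> x' \in S -> y' \notin S -> (k < #|cut G S|)%N.
  by case=> -> *; [apply: (@sparse_compl_cut_same_side G k A S x' y')
                  |apply: (@sparse_compl_cut_same_side G k (~: A) S x' y')].
(* a cut that separates no two vertices on the same side is A | ~: A itself *)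
case: (boolP [exists p : V * V,
    [&& p.1 \in S, p.2 \notin S & (p.1 \in A) == (p.2 \in A)]]) => [|/existsPn sepA].
  case/existsP => -[a b] /= /and3P[aS bS /eqP ab].
  case: (boolP (a \in A)) => aA; last move: (aA).
    by apply: (same A a b); rewrite -?ab //; left.
  by move=> ?; apply: (same (~: A) a b); rewrite ?inE -?ab //; right.
have opp a b : a \in S -> b \notin S -> (a \in A) != (b \in A).
  by move=> aS bS; have := sepA (a, b); rewrite /= aS bS.
have SE z : (z \in S) = ((z \in A) == (x \in A)).
  apply/idP/idP => [zS|].
    have := opp _ _ zS yS; have := opp _ _ xS yS.
    by do 3!case: (_ \in A).
  by apply: contraTT => /(opp _ _ xS); rewrite eq_sym.
have cutSA : #|cut G S| = #|cut G A|.
  case: (boolP (x \in A)) => xA.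
    by congr #|pred_of_set (cut G _)|; apply/setP => z; rewrite SE xA eqb_id.
  rewrite -card_cutC; congr #|pred_of_set (cut G _)|.
  by apply/setP => z; rewrite inE SE (negbTE xA) eqbF_neg negbK.
rewrite cutSA.
have : (#|setX A (~: A)| <= #|cut (compl G) A :|: cut G A|)%N.
  apply/subset_leq_card/subsetP => -[a b]; rewrite in_setX inE => /andP[aA bA].
  rewrite inE !in_cut aA bA /= /compl_adj; case: eqP => [ab|_] /=; last by rewrite orNb.
  by rewrite -ab aA in bA.
rewrite cardsX => /leq_trans /(_ (leq_card_setU _ _)); nia.
Qed.

Lemma degree_compl G x : (degree (compl G) x + degree G x).+1 = #|V|.
Proof.
rewrite /degree -cardsT (cardsD1 x [set: V]) inE add1n; congr _.+1.
rewrite -(cardsID [set y | adj G x y] ([set: V] :\ x)) addnC.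
congr (_ + _)%N; apply: eq_card => y; rewrite !inE /= ?andbT /compl_adj.
  by case: eqP => [->|]; rewrite ?adj_irr // eq_sym.
by rewrite eq_sym andbC.
Qed.

(** In the complement every vertex has at least [3 * k] neighbours. If the side
    of [x] had at most [2 * k] vertices, then more than [k] neighbours of [x]
    would lie across the cut, since [x] is not its own neighbour. *)
Lemma sparse_compl_cut_side G k (A : {set V}) x :
    (forall z, (degree G z + 3 * k < #|V|)%N) ->
    (#|cut (compl G) A| <= k)%N -> x \in A -> (k.*2 < #|A|)%N.
Proof.
move=> degG Ak xA.
have dx := degree_compl G x; have := degG x; rewrite -dx => degx.
rewrite ltnNge; apply/negP => A2k.
have : (#|[set y | adj (compl G) x y] :\: A| <= k)%N.
  apply: leq_trans Ak.
  have pairI : injective (fun z : V => (x, z)) by move=> a b [].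
  rewrite -(card_imset _ pairI); apply/subset_leq_card/subsetP => _ /imsetP[z + ->].
  by rewrite in_setD inE in_cut xA.
have : (#|[set y | adj (compl G) x y] :&: A| < #|A|)%N.
  apply: proper_card; apply/properP; split; first exact: subsetIr.
  by exists x => //; rewrite !inE adj_irr.
have := cardsID A [set y | adj (compl G) x y]; rewrite -/(degree (compl G) x).
lia.
Qed.

Lemma edge_connected_or_compl G k :
    (forall x, (degree G x + 3 * k < #|V|)%N) ->
  edge_connected G k.+1 \/ edge_connected (compl G) k.+1.
Proof.
move=> degG; case: (pselect (edge_connected (compl G) k.+1)) => [|noH]; first by right.
left; have [A [x [y [xA yA Ak]]]] : exists (A : {set V}) x y,
    [/\ x \in A, y \notin A & (#|cut (compl G) A| <= k)%N].
  apply: contrapT => nocut; apply: noH => A x y xA yA.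
  by rewrite ltnNge; apply/negP => Ak; apply: nocut; exists A, x, y.
apply: (sparse_compl_cut_edge_connected Ak); first exact: sparse_compl_cut_side xA.
by apply: (@sparse_compl_cut_side G k _ y); rewrite ?card_cutC ?inE.
Qed.

End Cuts.

(** * Dirichlet energy *)

Section Energy.
Variables (R : realType) (V : finType) (G : sgraph V).
Implicit Types (f : V -> R) (k : nat).

(** Twice the usual Dirichlet form, as every edge occurs in both directions. *)
Definition energy f : R :=
  \sum_(p : V * V | adj G p.1 p.2) (f p.1 - f p.2) ^+ 2.

Lemma energy_laplacian f :
  energy f = 2 * \sum_x f x * ((degree G x)%:R * f x - \sum_(y | adj G x y) f y).
Proof.
have LE : \sum_x f x * ((degree G x)%:R * f x - \sum_(y | adj G x y) f y) =
    \sum_x \sum_(y | adj G x y) (f x ^+ 2 - f x * f y).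
  apply: eq_bigr => x _; rewrite mulrBr mulr_sumr sumrB; congr (_ - _).
  rewrite sumr_const /degree cardsE -mulr_natl; ring.
have LE' : \sum_x \sum_(y | adj G x y) (f x ^+ 2 - f x * f y) =
    \sum_x \sum_(y | adj G x y) (f y ^+ 2 - f x * f y).
  rewrite (exchange_big_dep predT) //=; apply: eq_bigr => x _.
  under eq_bigl do rewrite adj_sym.
  by apply: eq_bigr => y _; rewrite [f x * _]mulrC.
rewrite mulr_natl mulr2n LE {2}LE' -big_split /energy /=.
rewrite -(pair_big_dep predT (fun x y => adj G x y) (fun x y => (f x - f y) ^+ 2)) /=.
apply: eq_bigr => x _; rewrite -big_split; apply: eq_bigr => y _ /=; ring.
Qed.

Lemma energy_ge_card f (A : {set V * V}) (w : R) :
    0 <= w -> (forall x y, (x, y) \in A -> adj G x y && (w <= `|f x - f y|)) ->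
  #|A|%:R * w ^+ 2 <= energy f.
Proof.
move=> w0 Aw; rewrite mulr_natl -sumr_const /energy.
rewrite [leRHS](bigID (mem A)) /= addrC.
rewrite [X in _ + X](eq_bigl (mem A)) => [|[x y]] /=; last first.
  by apply/andb_idl => /Aw /andP[].
apply: ler_wpDl; first by apply: sumr_ge0 => p _; rewrite sqr_ge0.
apply: ler_sum => -[x y] /Aw /andP[_] /= wf.
by rewrite -[leRHS]real_normK ?num_real // ler_sqr ?nnegrE.
Qed.

(** Cut the interval from [f x0] to [f x1] into [K] layers of width [3 * w]. If a
    layer has no vertex in its middle third, then the vertices above and those
    below that third form a cut all of whose edges have length at least [w]. If it has one, then either
    at least [k / 2] edges at that vertex leave the layer, and these have length
    at least [w], or more than [k / 2] of its neighbours lie in the layer; the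
    latter cannot happen for every layer, as the layers are disjoint and
    [2 * #|V| < K * k]. *)
Lemma energy_ge_edge_connected f k K (w : R) x0 x1 :
    edge_connected G k -> 0 < w -> (forall x, 0 <= f x) ->
    f x0 = 0 -> f x1 = K%:R * (3 * w) -> (2 * #|V| < K * k)%N ->
  k%:R * w ^+ 2 <= 2 * energy f.
Proof.
move=> Gk w0 f0 fx0 fx1 nKk; have w3 : 0 < 3 * w by lra.
rewrite leNgt; apply/negP => Elt.
have few_long (A : {set V * V}) :
    (forall x y, (x, y) \in A -> adj G x y && (w <= `|f x - f y|)) ->
    (2 * #|A| < k)%N.
  move=> /(energy_ge_card (ltW w0)) => EA; rewrite -(ltr_nat R) natrM.
  have w2 : 0 < w ^+ 2 by rewrite exprn_gt0.
  by rewrite -(ltr_pM2r w2); lra.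
pose layer x := Num.truncn (f x / (3 * w)).
have layerE x i : (layer x == i) = (i%:R * (3 * w) <= f x < i.+1%:R * (3 * w)).
  rewrite /layer truncn_eq; last by rewrite divr_ge0 ?f0 ?ltW.
  by rewrite ler_pdivlMr // ltr_pdivrMr.
have heavy (i : 'I_K) : (k <= 2 * #|[set x | layer x == i]|)%N.
  have iK : i.+1%:R * (3 * w) <= K%:R * (3 * w).
    by rewrite ler_pM2r // ler_nat ltn_ord.
  have i0 : 0 <= i%:R * (3 * w) by rewrite mulr_ge0 ?ler0n ?ltW.
  have iS : i.+1%:R * (3 * w) = i%:R * (3 * w) + 3 * w by rewrite -natr1; ring.
  set t := i%:R * (3 * w) in iK i0 iS.
  (* is there a vertex in the middle third of layer [i]? *)
  case: (pselect (exists x, t + w <= f x <= t + 2 * w)) => [[x /andP[xl xr]]|nox];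
    last first.
    have : (k <= #|cut G [set x | (t + w <= f x)%R]|)%N.
      by apply: (Gk _ x1 x0); rewrite inE ?fx1 ?fx0; lra.
    move=> kc.
    suff : (2 * #|cut G [set x | (t + w <= f x)%R]| < k)%N by lia.
    apply: few_long => x y; rewrite in_cut !inE => /and3P[fx fy ->] /=.
    rewrite ger0_norm; last lra.
    suff : t + 2 * w < f x by lra.
    by rewrite ltNge; apply/negP => fx'; apply: nox; exists x; rewrite fx.
  have kx : (k <= degree G x)%N.
    have [xx0|/degree_ge_edge_connected -> //] := eqVneq x x0.
    by rewrite xx0 in xl; lra.
  have : (2 * #|[set (x, y) | y in [set y | adj G x y] :\: [set y | layer y == i]]| < k)%N.
    apply: few_long => a y /imsetP[z]; rewrite !inE layerE => /andP[zi xz] [-> ->].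
    rewrite xz /= ler_normr; move: zi; rewrite iS -/t; lra.
  rewrite card_imset; last by move=> ? ? [].
  have := cardsID [set y | layer y == i] [set y | adj G x y].
  rewrite -/(degree G x).
  have := subset_leq_card (subsetIr [set y | adj G x y] [set y | layer y == i]).
  lia.
have : (K * k <= \sum_(i < K) 2 * #|[set x | layer x == i]|)%N.
  rewrite -[K in (K * k)%N]card_ord -sum_nat_const; exact: leq_sum.
rewrite -big_distrr /= => /(leq_trans nKk); rewrite ltn_pmul2l // ltnNge => /negP.
apply.
under eq_bigr do rewrite -sum1dep_card big_mkcond /=.
rewrite exchange_big /= -sum1_card; apply: leq_sum => x _.
case: (ltnP (layer x) K) => [xK|Kx].
  rewrite (bigD1 (Ordinal xK)) //= eqxx big1 // => i; rewrite -val_eqE /= eq_sym.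
  by move=> /negbTE ->.
by rewrite big1 // => i _; case: eqP => // xi; move: (ltn_ord i); rewrite -xi ltnNge Kx.
Qed.

End Energy.

(** * First hitting times of the simple random walk *)

Section HittingTimes.
Variables (R : realType) (V : finType) (G : sgraph V) (j : V).
Hypothesis degG : forall x, (0 < degree G x)%N.

Lemma sum_walk_step x (f : V -> R) :
  \sum_y walk_step G R x y * f y = (degree G x)%:R^-1 * \sum_(y | adj G x y) f y.
Proof.
rewrite mulr_sumr [RHS]big_mkcond; apply: eq_bigr => y _.
by rewrite /walk_step; case: ifP; rewrite ?mul0r.
Qed.

Lemma sum_walk_step1 x : \sum_y walk_step G R x y = 1.
Proof.
under eq_bigr do rewrite -[walk_step _ _ _ _]mulr1.
by rewrite sum_walk_step sumr_const /degree cardsE mulVf // pnatr_eq0 -lt0n -cardsE degG.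
Qed.

Lemma hit_prob0 x : hit_prob G R x j 0 = (x == j)%:R.
Proof.
rewrite /hit_prob (eq_bigl (fun=> x == j)) => [|w]; last first.
  by rewrite tuple0 /=; case: (x == j).
case: (x == j); last by rewrite big_pred0.
rewrite (big_pred1 [tuple]) => [|w]; last by rewrite [w]tuple0; exact: (esym (eqxx _)).
by rewrite /traj_prob big_ord0.
Qed.

Lemma hit_probS x t : hit_prob G R x j t.+1 =
  if x == j then 0 else \sum_y walk_step G R x y * hit_prob G R y j t.
Proof.
rewrite /hit_prob; case: ifP => [xj|xj].
  by rewrite big_pred0 // => w; rewrite /= xj.
under eq_bigl do rewrite /= xj eqSS.
transitivity (\sum_(p : V * t.-tuple V | index j (p.1 :: p.2) == t)
    walk_step G R x p.1 * traj_prob G R p.1 p.2).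
  rewrite (reindex (fun p : V * t.-tuple V => cons_tuple p.1 p.2)) /=; last first.
    exists (fun w : t.+1.-tuple V => (thead w, [tuple of behead w])).
      by move=> [y w] _; congr pair; apply: val_inj.
    by move=> w _; apply: val_inj; case/tupleP: w.
  apply: eq_bigr => -[y w] _; rewrite /traj_prob big_ord_recl /=.
  (* the two trajectories are read with different default vertices *)
  congr (_ * _); apply: eq_bigr => k _ /=.
  by congr walk_step; apply: set_nth_default; rewrite /= size_tuple; case: k => k /=; lia.
rewrite -(pair_big_dep predT (fun y (w : t.-tuple V) => index j (y :: w) == t)
  (fun y w => walk_step G R x y * traj_prob G R y w)) /=.
by apply: eq_bigr => y _; rewrite mulr_sumr.
Qed.

(** The probability that the walk from [x] has not reached [j] by time [t]. *)
Definition survival t x : R := 1 - \sum_(u < t.+1) hit_prob G R x j u.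

Lemma survival0 x : survival 0 x = (x != j)%:R.
Proof. by rewrite /survival big_ord1 hit_prob0; case: eqP; rewrite ?subrr ?subr0. Qed.

Lemma survivalS t x : survival t.+1 x =
  if x == j then 0 else \sum_y walk_step G R x y * survival t y.
Proof.
rewrite /survival big_ord_recl hit_prob0 opprD addrA.
under eq_bigr do rewrite hit_probS.
case: ifP => xj; first by rewrite big1 // subrr subr0.
rewrite subr0 exchange_big /=.
under [in RHS]eq_bigr do rewrite mulrBr mulr1 mulr_sumr.
by rewrite sumrB sum_walk_step1.
Qed.

Lemma walk_step_ge0 x y : 0 <= walk_step G R x y.
Proof. by rewrite /walk_step; case: ifP => // _; rewrite invr_ge0. Qed.

Lemma hit_prob_ge0 x t : 0 <= hit_prob G R x j t.
Proof. by apply: sumr_ge0 => w _; apply: prodr_ge0 => k _; exact: walk_step_ge0. Qed.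

Lemma survival_ge0 t x : 0 <= survival t x.
Proof.
elim: t x => [|t IH] x; first by rewrite survival0.
rewrite survivalS; case: ifP => // _.
by apply: sumr_ge0 => y _; rewrite mulr_ge0 ?walk_step_ge0.
Qed.

Lemma hit_prob_survival t x : hit_prob G R x j t.+1 = survival t x - survival t.+1 x.
Proof. by rewrite /survival [in X in _ - X]big_ord_recr /=; ring. Qed.

Lemma survival_nincr x : {homo survival^~ x : s t / (s <= t)%N >-> t <= s}.
Proof.
apply/nonincreasing_seqP => t.
by rewrite -subr_ge0 -hit_prob_survival hit_prob_ge0.
Qed.

(** The expectation of the hitting time of [j] truncated at [N]. *)
Definition truncated_hit N x : R := \sum_(t < N) survival t x.

Lemma truncated_hit_ge0 N x : 0 <= truncated_hit N x.
Proof. by apply: sumr_ge0 => t _; exact: survival_ge0. Qed.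

Lemma truncated_hit_target N : truncated_hit N j = 0.
Proof.
rewrite /truncated_hit big1 // => -[[|t] _] _ /=; first by rewrite survival0 eqxx.
by rewrite survivalS eqxx.
Qed.

(** Conditioning on the first step expresses the truncation at [N + 1] as one
    plus the mean over the neighbours of the truncation at [N], and the
    truncations increase with [N]. *)
Lemma truncated_hit_subsolution N x : x != j ->
  (degree G x)%:R * truncated_hit N x - \sum_(y | adj G x y) truncated_hit N y
    <= (degree G x)%:R.
Proof.
move=> xj; have d0 : 0 < (degree G x)%:R :> R by rewrite ltr0n degG.
have recS : truncated_hit N.+1 x = 1 + \sum_y walk_step G R x y * truncated_hit N y.
  rewrite /truncated_hit big_ord_recl survival0 xj; congr (_ + _).
  under [RHS]eq_bigr do rewrite mulr_sumr.
  rewrite [RHS]exchange_big; apply: eq_bigr => t _.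
  by rewrite /= survivalS (negbTE xj).
have : truncated_hit N x <= truncated_hit N.+1 x.
  by rewrite {2}/truncated_hit big_ord_recr lerDl survival_ge0.
rewrite recS sum_walk_step -(ler_pM2l d0) mulrDr mulr1 mulrA mulfV ?gt_eqF // mul1r.
lra.
Qed.

(** Pair the subsolution inequality with the function itself, which vanishes at
    [j], and bound degrees by [#|V|]. *)
Lemma energy_truncated_hit N (M : R) : 0 <= M ->
    (forall x, truncated_hit N x <= M) ->
  energy G (truncated_hit N) <= 2 * #|V|%:R ^+ 2 * M.
Proof.
move=> M0 hM; rewrite energy_laplacian -mulrA ler_pM2l //.
have -> : #|V|%:R ^+ 2 * M = \sum_(x : V) #|V|%:R * M :> R.
  by rewrite sumr_const -[RHS]mulr_natl; ring.
apply: ler_sum => x _; have [->|xj] := eqVneq x j.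
  by rewrite truncated_hit_target mul0r mulr_ge0.
have dV : (degree G x)%:R <= #|V|%:R :> R by rewrite ler_nat max_card.
apply: le_trans (_ : truncated_hit N x * (degree G x)%:R <= _).
  by rewrite ler_wpM2l ?truncated_hit_ge0 // truncated_hit_subsolution.
by rewrite mulrC ler_pM // truncated_hit_ge0.
Qed.

Lemma sum_hit_prob N x : \sum_(t < N.+1) hit_prob G R x j t = 1 - survival N x.
Proof. by rewrite /survival subKr. Qed.

(** Summation by parts: the probability of hitting at time [t + 1] is the drop of
    [survival] from [t] to [t + 1]. *)
Lemma sum_time_hit_prob N x :
  \sum_(t < N.+1) t%:R * hit_prob G R x j t = truncated_hit N x - N%:R * survival N x.
Proof.
elim: N => [|N IH]; first by rewrite big_ord1 /truncated_hit big_ord0 !mul0r subrr.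
rewrite big_ord_recr IH /= /truncated_hit big_ord_recr /= hit_prob_survival.
rewrite -natr1; ring.
Qed.

(** Bounded truncated expectations force the walk to reach [j] almost surely:
    as [survival] decreases in time, [N.+1 * survival N] is at most the
    truncation at [N.+1]. So the infinite contribution to the hitting time
    vanishes. *)
Lemma hit_time_le x (C : R) :
  (forall N, truncated_hit N x <= C) -> (hit_time G R x j <= C%:E)%E.
Proof.
move=> hC.
have p0 t : (0 <= (hit_prob G R x j t)%:E)%E by rewrite lee_fin hit_prob_ge0.
have tp0 t : (0 <= (t%:R * hit_prob G R x j t)%:E)%E.
  by rewrite lee_fin mulr_ge0 ?hit_prob_ge0.
rewrite /hit_time; have -> : (\sum_(0 <= t <oo) (hit_prob G R x j t)%:E = 1)%E.
  apply: cvg_lim => //; rewrite -cvg_shiftS /=.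
  have -> : (fun N => (\sum_(0 <= t < N.+1) (hit_prob G R x j t)%:E)%E) =
      EFin \o (fun N => 1 - survival N x).
    by apply/funext => N; rewrite sumEFin big_mkord sum_hit_prob.
  apply: cvg_EFin; first exact: nearW.
  rewrite -[X in (_ --> X)%classic]subr0; apply: cvgB; first exact: cvg_cst.
  apply: (@squeeze_cvgr _ _ _ _ (fun=> 0) (fun N => C * harmonic N)).
  - apply: nearW => N; rewrite survival_ge0 /= ler_pdivlMr ?ltr0n //.
    apply: le_trans (hC N.+1); rewrite mulr_natr /truncated_hit.
    rewrite -[N.+1 in X in X <= _]card_ord -sumr_const; apply: ler_sum => t _.
    by apply: survival_nincr; rewrite -ltnS.
  - exact: cvg_cst.
  - rewrite -[X in (_ --> X)%classic](mulr0 C).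
    by apply: cvgM; [exact: cvg_cst|exact: cvg_harmonic].
rewrite subee // mule0 adde0.
apply: lime_le; first by apply: is_cvg_nneseries.
apply: nearW => -[|N]; first by rewrite big_geq // lee_fin; have := hC 0%N;
  rewrite /truncated_hit big_ord0.
rewrite sumEFin big_mkord sum_time_hit_prob lee_fin.
apply: le_trans (hC N).
by rewrite gerBl mulr_ge0 ?survival_ge0.
Qed.

End HittingTimes.

(** * Kemeny's constant *)

(** The ordered adjacent pairs are counted by the degrees, and an edge comes from
    at most two of them. *)
Lemma sum_degree_le (V : finType) (G : sgraph V) :
  (\sum_x degree G x <= 2 * #|edges G|)%N.
Proof.
have -> : (\sum_x degree G x = \sum_(p : V * V | adj G p.1 p.2) 1)%N.
  under eq_bigr do rewrite /degree -sum1dep_card.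
  by rewrite (pair_big_dep predT (fun x y => adj G x y) (fun _ _ => 1%N)).
rewrite (partition_big (fun p : V * V => [set p.1; p.2]) (mem (edges G))) /=; last first.
  move=> [x y] /= xy; rewrite inE; apply/existsP; exists x; apply/existsP; exists y.
  by rewrite xy eqxx.
rewrite mulnC -sum_nat_const; apply: leq_sum => e.
rewrite inE => /existsP[a /existsP[b /andP[_ /eqP ->]]].
rewrite sum1dep_card; apply: leq_trans (_ : #|[set (a, b); (b, a)]| <= _)%N.
  apply/subset_leq_card/subsetP => -[x y]; rewrite inE /= => /andP[xy /eqP E].
  have xab : x \in [set a; b] by rewrite -E set21.
  have yab : y \in [set a; b] by rewrite -E set22.
  have a_xy : a \in [set x; y] by rewrite E set21.
  have b_xy : b \in [set x; y] by rewrite E set22.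
  have : x != y by apply: contraTneq xy => ->; rewrite adj_irr.
  move: xab yab a_xy b_xy; rewrite !inE !xpair_eqE.
  by do 2![case/orP => /eqP ->]; rewrite !eqxx ?orbT // !orbb ?andbT.
by rewrite cards2; case: (_ != _).
Qed.

Section KemenyBound.
Variables (R : realType) (V : finType) (G : sgraph V).
Variables (k K : nat) (eps : R).
Hypotheses (Gk : edge_connected G k) (eps0 : 0 < eps).
Hypotheses (epsk : eps * #|V|%:R <= k%:R) (nKk : (2 * #|V| < K * k)%N).

(** With [M] the maximum and [w = M / (3 * K)], the two energy bounds read
    [eps * n * w ^+ 2 <= 4 * n ^+ 2 * M]; dividing by [M] gives the constant. *)
Lemma truncated_hit_le i j N : i != j ->
  truncated_hit R G j N i <= 36 * K%:R ^+ 2 / eps * #|V|%:R.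
Proof.
move=> ij; have k0 : (0 < k)%N by case: k nKk => //; rewrite muln0.
have K0 : 0 < K%:R :> R by rewrite ltr0n; case: K nKk.
have degG x : (0 < degree G x)%N.
  apply: leq_trans k0 _; have [->|xi] := eqVneq x i.
    exact: degree_ge_edge_connected Gk ij.
  exact: degree_ge_edge_connected Gk xi.
set h := truncated_hit R G j N.
have [z _ zmax] := @Order.TotalTheory.arg_maxP _ _ _ i xpredT h isT.
have hz x : h x <= h z by exact: zmax.
apply: le_trans (hz i) _.
have h0 x : 0 <= h x by exact: truncated_hit_ge0.
have nneg : 0 <= 36 * K%:R ^+ 2 / eps * #|V|%:R :> R.
  by rewrite !mulr_ge0 ?invr_ge0 ?exprn_ge0 ?ler0n // ltW.
have [//|z0] := leP (h z) 0; first by move=> hz0; apply: le_trans hz0 nneg.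
pose w := h z / (3 * K%:R).
have w0 : 0 < w by rewrite divr_gt0 ?mulr_gt0.
have hw : h z = K%:R * (3 * w) by rewrite /w; field; rewrite gt_eqF.
have hj : h j = 0 by exact: truncated_hit_target.
have lo := energy_ge_edge_connected Gk w0 h0 hj hw nKk.
have up : energy G h <= 2 * #|V|%:R ^+ 2 * h z.
  by apply: energy_truncated_hit => //; exact: ltW.
have V0 : 0 < #|V|%:R :> R by rewrite ltr0n; apply/card_gt0P; exists i.
have bound : eps * #|V|%:R * w ^+ 2 <= 4 * #|V|%:R ^+ 2 * h z.
  apply: le_trans (ler_wpM2r _ epsk) _; first by rewrite exprn_ge0 // ltW.
  by apply: le_trans lo _; lra.
rewrite [leRHS]mulrAC ler_pdivlMr // -(ler_pM2l (mulr_gt0 V0 w0)).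
have K3 : 0 <= 3 * K%:R :> R by rewrite mulr_ge0.
by have := ler_wpM2r K3 bound; rewrite hw; lra.
Qed.

Lemma kemeny_le : (kemeny G R <= (36 * K%:R ^+ 2 / eps * #|V|%:R)%:E)%E.
Proof.
have nneg : 0 <= 36 * K%:R ^+ 2 / eps * #|V|%:R :> R.
  by rewrite !mulr_ge0 ?invr_ge0 ?exprn_ge0 ?ler0n // ltW.
have k0 : (0 < k)%N by case: k nKk => //; rewrite muln0.
rewrite /kemeny (edge_connected_connected k0 Gk).
case: pickP => [i _|_]; last by rewrite lee_fin.
apply: (@le_trans _ _ (\sum_(j | j != i) ((degree G j)%:R / (2 * #|edges G|%:R) *
    (36 * K%:R ^+ 2 / eps * #|V|%:R))%:E)%E).
  apply: lee_sum => j ji; rewrite [leRHS]EFinM.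
  apply: lee_wpmul2l; first by rewrite lee_fin divr_ge0 ?mulr_ge0.
  have degG x : (0 < degree G x)%N.
    apply: leq_trans k0 _; have [->|xi] := eqVneq x i.
      by apply: degree_ge_edge_connected Gk _; rewrite eq_sym; exact: ji.
    exact: degree_ge_edge_connected Gk xi.
  by apply: hit_time_le => // N; apply: truncated_hit_le; rewrite eq_sym.
rewrite sumEFin lee_fin -mulr_suml -mulr_suml ler_piMl //.
have [->|e0] := eqVneq #|edges G| 0%N; first by rewrite mulr0 invr0 mulr0.
rewrite ler_pdivrMr ?mulr_gt0 ?ltr0n ?lt0n // mul1r -natr_sum -natrM ler_nat.
apply: leq_trans (sum_degree_le G).
by rewrite [leqRHS](bigD1 i) //= leq_addl.
Qed.

End KemenyBound.

Lemma degree_le_max_degree (V : finType) (G : sgraph V) x :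
  (degree G x <= max_degree G)%N.
Proof. exact: (leq_bigmax x). Qed.

Theorem theorem3p1 (R : realType) (U : R) (hU0 : 0 < U) (hU1 : U < 1) :
  exists Psi : R, forall (n : nat) (G : sgraph 'I_n),
    (max_degree G)%:R <= U * n%:R ->
    (mine (kemeny G R) (kemeny (compl G) R) <= (n%:R * Psi)%:E)%E.
Proof.
(* [degree x + 3 * k < n] must hold for [k <= eps * n]: any [eps] below
   [(1 - U) / 3] does *)
pose eps : R := (1 - U) / 4; have eps0 : 0 < eps by rewrite /eps; lra.
pose K := (Num.truncn (2 / eps)).+1.
exists (36 * K%:R ^+ 2 / eps) => n G maxG; rewrite mulrC.
have [n0|n0] := posnP n.
  have ke (H : sgraph 'I_n) : kemeny H R = 0%E.
    have no (x : 'I_n) : False by case: x => x; rewrite n0.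
    rewrite /kemeny ifT; last by apply/forallP => x; case: (no x).
    by case: pickP => // x; case: (no x).
  by rewrite !ke minxx lee_fin n0 mulr0.
have nR : 0 < n%:R :> R by rewrite ltr0n.
pose k := Num.truncn (eps * n%:R).
have /andP[kle klt] : k%:R <= eps * n%:R < k.+1%:R.
  by apply: truncn_itv; rewrite mulr_ge0 ?ltW.
have degG x : (degree G x + 3 * k < #|'I_n|)%N.
  rewrite card_ord -(ltr_nat R) natrD natrM.
  have : (degree G x)%:R <= U * n%:R.
    by apply: le_trans maxG; rewrite ler_nat degree_le_max_degree.
  move: kle; rewrite /eps => kle dle.
  have : 0 < (1 - U) * n%:R by rewrite mulr_gt0 // subr_gt0.
  lra.
have epsk : eps * #|'I_n|%:R <= k.+1%:R by rewrite card_ord ltW.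
have nKk : (2 * #|'I_n| < K * k.+1)%N.
  rewrite card_ord -(ltr_nat R) !natrM.
  have -> : 2 * n%:R = 2 / eps * (eps * n%:R) :> R by field; rewrite gt_eqF.
  apply: ltr_pM => //; try exact: truncnS_gt.
    by rewrite divr_ge0 // ltW.
  by rewrite mulr_ge0 // ltW.
have bound (H : sgraph 'I_n) : edge_connected H k.+1 ->
    (kemeny H R <= (36 * K%:R ^+ 2 / eps * n%:R)%:E)%E.
  by move=> Hk; have := kemeny_le Hk eps0 epsk nKk; rewrite card_ord.
rewrite ge_min; apply/orP.
by case: (edge_connected_or_compl degG) => /bound ->; [left|right].
Qed.
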